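(* Let $p,q,r\in(0,1)$ with $p+q+r=1$. Let $X_1,\eta_2,\eta_3,\ldots$ be independent random variables, each taking the values $1,-1,0$ with probabilities $p,q,r$ respectively, and let $K_3,K_4,\ldots$ be independent random variables, independent of the previous ones, with $K_{n+1}$ uniformly distributed on $\{1,n\}$. Set $X_2=\eta_2X_1$, $X_{n+1}=\eta_{n+1}X_{K_{n+1}}$ for $n\ge2$, and $S_n=\sum_{k=1}^nX_k$. Then, as $n\to\infty$, $S_n/n$ converges in distribution to a random variable $S$ taking the value $\frac{p-q}{2+q-p}$ with probability $p$, the value $0$ with probability $r$, and the value $-\frac{p-q}{2+q-p}$ with probability $q$. Moreover, for every real $\alpha>0$, $E|S_n/n|^\alpha\to E|S|^\alpha$, and for every positive integer $k$, $E\big((S_n/n)^k\big)\to E(S^k)$, as $n\to\infty$.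
   Context: This is the elephant random walk with delays in which the elephant remembers only the first step and the most recent step: step $n+1$ ($n\ge2$) picks one of $X_1,X_n$ uniformly at random and repeats it (probability $p$), reverses it (probability $q$), or is $0$ (probability $r$). Note that $|S_n/n|\le1$ for all $n$. *)

(* Defs.v *)
From HB Require Import structures.
From mathcomp Require Import all_boot all_order all_algebra.
From mathcomp Require Import all_classical all_reals all_analysis.
Set Implicit Arguments. Unset Strict Implicit. Unset Printing Implicit Defensive.
Import Order.TTheory GRing.Theory Num.Theory.
Import numFieldNormedType.Exports.
Local Open Scope classical_set_scope.
Local Open Scope ring_scope.

(* Index set of the driving random variables:
   None         = X_1,
   Some (inl n) = eta_n   (n >= 2),
   Some (inr n) = K_n     (n >= 3). *)
Definition idx := option (nat + nat).

Definition valid_idx (i : idx) : bool :=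
  match i with
  | None => true
  | Some (inl n) => (2 <= n)%N
  | Some (inr n) => (3 <= n)%N
  end.

Definition drive (T : Type) (R : realType) (X1 : T -> R) (eta : nat -> T -> R)
  (K : nat -> T -> nat) (i : idx) : T -> R :=
  match i with
  | None => X1
  | Some (inl n) => eta n
  | Some (inr n) => fun t => (K n t)%:R
  end.

Definition discrete_mutually_independent (d : measure_display)
  (T : measurableType d) (R : realType) (P : probability T R)
  (I : eqType) (valid : I -> bool) (F : I -> T -> R) : Prop :=
  forall (s : seq I), uniq s -> all valid s -> forall v : I -> R,
    P [set t | all (fun i => F i t == v i) s] =
    (\prod_(i <- s) P [set t | F i t = v i])%E.

(* The sequence [:: X_1; ...; X_n] of the elephant walk:
   X_2 = eta_2 X_1, X_{n+1} = eta_{n+1} X_{K_{n+1}} for n >= 2. *)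
Fixpoint elephant_steps (T : Type) (R : realType) (X1 : T -> R)
  (eta : nat -> T -> R) (K : nat -> T -> nat) (n : nat) (t : T) : seq R :=
  match n with
  | 0 => [::]
  | 1 => [:: X1 t]
  | m.+1 => let s := elephant_steps X1 eta K m t in
            let j := if m == 1%N then 0%N else (K m.+1 t).-1 in
            rcons s (eta m.+1 t * nth 0 s j)
  end.

Definition elephant_X (T : Type) (R : realType) (X1 : T -> R)
  (eta : nat -> T -> R) (K : nat -> T -> nat) (k : nat) (t : T) : R :=
  nth 0 (elephant_steps X1 eta K k t) k.-1.

Definition elephant_S (T : Type) (R : realType) (X1 : T -> R)
  (eta : nat -> T -> R) (K : nat -> T -> nat) (n : nat) (t : T) : R :=
  \sum_(1 <= k < n.+1) elephant_X X1 eta K k t.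

Definition limit_expect (R : realType) (p q r : R) (g : R -> R) : R :=
  let L := (p - q) / (2 + q - p) in
  p * g L + r * g 0 + q * g (- L).

(* Main.v *)
(* Put L = (p - q) / (2 + q - p).  Given the past, X_(n+1) has mean
   (p - q) / 2 * (X_1 + X_n), and L solves (1 + L) (p - q) / 2 = L; hence
   M_n = S_n + L X_n - n L X_1 is a martingale.  Its increments are at most 4 in
   absolute value, so E M_n^2 <= 16 n and E (S_n / n - L X_1)^2 <= 34 / n.
   As S_n / n and L X_1 live in [-1, 1], where a continuous f satisfies
   |f x - f y| <= e + C (x - y)^2, it follows that E f (S_n / n) tends to
   E f (L X_1); powers and absolute moments are particular functions f.
   Since finitely many discrete variables determine S_n, all expectations are
   computed as iterated finite sums over the values of these variables. *)
Require Import Defs.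
From mathcomp Require Import all_boot all_order all_algebra.
From mathcomp Require Import ring lra.
From mathcomp Require Import all_classical all_reals all_analysis.
From mathcomp Require Import measurable_realfun.
Set Implicit Arguments.
Unset Strict Implicit.
Unset Printing Implicit Defensive.
Import Order.TTheory GRing.Theory Num.Theory.
Import numFieldNormedType.Exports.
Local Open Scope classical_set_scope.
Local Open Scope ring_scope.

Section real_analysis.
Context {R : realType}.

Lemma ler_sqr_norm (x c : R) : `|x| <= c -> x ^+ 2 <= c ^+ 2.
Proof.
move=> xc; rewrite -[leLHS]real_normK ?num_real//.
by rewrite lerXn2r ?nnegrE// (le_trans _ xc).
Qed.

(* Nearby points are handled by continuity, distant ones by boundedness, the
   term [C * `|x - y| ^+ 2] being then large. *)
Lemma compact_continuous_sqr_modulus {V W : normedModType R} (f : V -> W)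
    (A : set V) (e : R) : continuous f -> compact A -> 0 < e ->
  \forall C \near +oo, forall x y, A x -> A y ->
    `|f x - f y| <= e + C * `|x - y| ^+ 2.
Proof.
move=> cf cA e_gt0; have e2_gt0 : 0 < e / 2 by rewrite divr_gt0.
have [M [_ M_bound]] :=
  compact_bounded (continuous_compact (continuous_subspaceT cf) cA).
have fM x : A x -> `|f x| <= `|M| + 1.
  move=> Ax; apply: (M_bound (`|M| + 1)); last by exists x.
  by rewrite (le_lt_trans (ler_norm M))// ltrDl.
have local_bound x : A x -> \forall x' \near x & C \near +oo,
    A x' -> forall y, A y -> `|f x' - f y| <= e + C * `|x' - y| ^+ 2.
  move=> Ax.
  have /cvgrPdist_le/(_ _ e2_gt0)/nbhs_normP[d /= d_gt0 fd] := cf x.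
  have d2_gt0 : 0 < d / 2 by rewrite divr_gt0.
  near=> x' C => Ax' y Ay.
  have C_ge : 2 * (`|M| + 1) / (d / 2) ^+ 2 <= C.
    by near: C; apply: nbhs_pinfty_ge; exact: num_real.
  have C_ge0 : 0 <= C.
    have num_ge0 : 0 <= 2 * (`|M| + 1) by rewrite mulr_ge0// addr_ge0.
    by apply: le_trans C_ge; apply: divr_ge0 => //; exact/exprn_ge0/ltW.
  have x'_near : `|x - x'| < d / 2.
    by near: x'; apply/nbhs_normP; exists (d / 2).
  have [y_near|y_far] := ltP `|x' - y| (d / 2).
    rewrite -[leLHS]addr0 lerD ?mulr_ge0//.
    rewrite (le_trans (ler_distD (f x) _ _))// [e]splitr lerD//.
      by rewrite distrC fd//=; lra.
    rewrite fd//= (le_lt_trans (ler_distD x' _ _))//.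
    by rewrite [d]splitr ltrD.
  rewrite -[leLHS]add0r (lerD (ltW e_gt0))//.
  rewrite (@le_trans _ _ (2 * (`|M| + 1)))//.
    by rewrite mulr_natl mulr2n (le_trans (ler_normB _ _))// lerD ?fM.
  move: C_ge; rewrite ler_pdivrMr ?exprn_gt0// => /le_trans; apply.
  by rewrite ler_wpM2l// lerXn2r// ?nnegrE// ltW.
have := (compact_near_coveringP A).1 cA R _ _ _ local_bound.
by move/(_ _); apply: filterS => C C_bound x y Ax; exact: C_bound.
Unshelve. all: by end_near. Qed.

Lemma continuous_norm_powR {V : normedModType R} (a : R) :
  0 < a -> continuous (fun x : V => `|x| `^ a).
Proof.
move=> a_gt0 x; have [->|x_neq0] := eqVneq x 0.
  rewrite /continuous_at normr0 powR0 ?gt_eqF//.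
  apply/cvgr0Pnorm_le => e e_gt0; apply/nbhs_normP.
  exists (e `^ a^-1) => [|y /=]; first exact: powR_gt0.
  rewrite sub0r normrN => y_lt; rewrite ger0_norm ?powR_ge0//.
  have -> : e = (e `^ a^-1) `^ a.
    by rewrite -powRrM mulVf ?gt_eqF// powRr1// ltW.
  by apply: ge0_ler_powR; rewrite ?nnegrE ?powR_ge0// ltW.
have powR_continuous : {for `|x|, continuous (fun y : R => y `^ a)}.
  apply/differentiable_continuous/derivable1_diffP/derivable_powR.
  by rewrite in_itv/= andbT normr_gt0.
exact: (continuous_comp (@norm_continuous _ V x) powR_continuous).
Qed.

End real_analysis.

(* A finitely supported law is the list of its atoms and their masses. *)
Fixpoint iexpect (R : realType) (I : eqType) (law : I -> seq (R * R))
    (s : seq I) (phi : (I -> R) -> R) (v : I -> R) : R :=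
  if s is i :: s' then
    \sum_(a <- law i) a.2 * iexpect law s' phi [eta v with i |-> a.1]
  else phi v.

Definition determined_by (I : eqType) (R A : Type) (s : seq I)
    (phi : (I -> R) -> A) : Prop :=
  forall u v, {in s, u =1 v} -> phi u = phi v.

Lemma sub_determined_by (I : eqType) (R A : Type) (s s' : seq I)
    (phi : (I -> R) -> A) : {subset s <= s'} ->
  determined_by s phi -> determined_by s' phi.
Proof. by move=> ss' phi_s u v uv; apply: phi_s => i /ss'; exact: uv. Qed.

Lemma determined_by_update (I : eqType) (R A : Type) (s : seq I)
    (phi : (I -> R) -> A) v i x : determined_by s phi -> i \notin s ->
  phi [eta v with i |-> x] = phi v.
Proof.
move=> phi_s i_notin; apply: phi_s => j js /=.
by case: eqP => // ji; rewrite -ji js in i_notin.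
Qed.

Section iterated_expectation.
Context {R : realType} {I : eqType}.
Variable law : I -> seq (R * R).
Implicit Types (s : seq I) (phi psi : (I -> R) -> R) (u v : I -> R).

Local Notation E := (iexpect law).

Definition admissible v := forall i, v i \in unzip1 (law i).

Lemma admissible_update v i a : admissible v -> a \in law i ->
  admissible [eta v with i |-> a.1].
Proof. by move=> vA aA j /=; case: eqP => // ->; exact: map_f. Qed.

Lemma iexpect_cat s1 s2 phi v : E (s1 ++ s2) phi v = E s1 (E s2 phi) v.
Proof. by elim: s1 v => //= i s1 IH v; apply: eq_bigr => a _; rewrite IH. Qed.

Lemma iexpectZ s c phi v : E s (fun u => c * phi u) v = c * E s phi v.
Proof.
elim: s v => //= i s IH v; rewrite big_distrr/=.
by apply: eq_bigr => a _; rewrite IH mulrCA.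
Qed.

Lemma iexpectD s phi psi v :
  E s (fun u => phi u + psi u) v = E s phi v + E s psi v.
Proof.
elim: s v => //= i s IH v; rewrite -big_split/=.
by apply: eq_bigr => a _; rewrite IH mulrDr.
Qed.

Lemma iexpectN s phi v : E s (fun u => - phi u) v = - E s phi v.
Proof.
rewrite -mulN1r -iexpectZ; congr iexpect.
by apply/funext => u; rewrite mulN1r.
Qed.

Lemma iexpectB s phi psi v :
  E s (fun u => phi u - psi u) v = E s phi v - E s psi v.
Proof. by rewrite iexpectD iexpectN. Qed.

Lemma iexpectMl_determined s s' phi psi v : determined_by s phi ->
  ~~ has (mem s') s -> E s' (fun u => phi u * psi u) v = phi v * E s' psi v.
Proof.
move=> phi_s; elim: s' v => //= i s' IH v; rewrite has_sym/= => /norP[si ss'].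
rewrite big_distrr/=; apply: eq_bigr => a _; rewrite IH 1?has_sym// mulrCA.
by rewrite (determined_by_update _ _ phi_s).
Qed.

Hypothesis law_sum1 : forall i, \sum_(a <- law i) a.2 = 1.

Lemma iexpect_cst s c v : E s (fun=> c) v = c.
Proof.
elim: s v => //= i s IH v.
by under eq_bigr do rewrite IH; rewrite -mulr_suml law_sum1 mul1r.
Qed.

Lemma iexpect_determined s s' phi v : determined_by s phi ->
  ~~ has (mem s') s -> E s' phi v = phi v.
Proof.
move=> phi_s ss'; rewrite -[RHS]mulr1 -(iexpect_cst s' 1 v).
rewrite -(iexpectMl_determined _ _ phi_s ss'); congr iexpect.
by apply/funext => u; rewrite mulr1.
Qed.

Lemma iexpect_sqr_addr s s' phi psi v : determined_by s phi ->
  ~~ has (mem s') s -> E s' psi v = 0 ->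
  E s' (fun u => (phi u + psi u) ^+ 2) v =
  phi v ^+ 2 + E s' (fun u => psi u ^+ 2) v.
Proof.
move=> phi_s ss' psi0.
rewrite (_ : (fun u => _) =
    fun u => phi u ^+ 2 + 2 * (phi u * psi u) + psi u ^+ 2); last first.
  by apply/funext => u; rewrite sqrrD mulr_natl.
rewrite !iexpectD iexpectZ (iexpectMl_determined _ _ phi_s)// psi0 !mulr0 addr0.
by rewrite (iexpect_determined (s := s)) // => u w /phi_s ->.
Qed.

Hypothesis law_ge0 : forall i a, a \in law i -> 0 <= a.2.

Lemma ler_iexpect s phi psi v : (forall u, admissible u -> phi u <= psi u) ->
  admissible v -> E s phi v <= E s psi v.
Proof.
move=> le_phi_psi; elim: s v => [|i s IH v vA /=]; first exact: le_phi_psi.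
rewrite big_seq [leRHS]big_seq; apply: ler_sum => a aA.
by apply: ler_wpM2l; [exact: law_ge0 aA|exact/IH/admissible_update].
Qed.

Lemma iexpect_le_cst s phi c v : (forall u, admissible u -> phi u <= c) ->
  admissible v -> E s phi v <= c.
Proof. by move=> le_c vA; rewrite -[leRHS](iexpect_cst s _ v) ler_iexpect. Qed.

Lemma ler_norm_iexpect s phi v : admissible v ->
  `|E s phi v| <= E s (fun u => `|phi u|) v.
Proof.
move=> vA; rewrite ler_norml -iexpectN.
by rewrite !ler_iexpect// => u _; rewrite ?ler_norm// lerNl ler_normr lexx orbT.
Qed.

End iterated_expectation.

Section expectation_of_independent.
Context {d : measure_display} {T : measurableType d} {R : realType}.
Context (P : probability T R).

Lemma measurable_fiber (f : T -> R) x :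
  measurable_fun setT f -> measurable [set t | f t = x].
Proof.
move=> mf; rewrite -[X in measurable X]setTI.
exact: (mf measurableT _ (measurable_set1 x)).
Qed.

Lemma integral_fibers (f G : T -> R) (A : set T) (s : seq R) :
  measurable_fun setT f -> measurable_fun setT G -> measurable A -> uniq s ->
  (\sum_(x <- s) P [set t | f t = x])%E = 1%E ->
  (\int[P]_(t in A) (G t)%:E)%E =
    (\sum_(x <- s) \int[P]_(t in A `&` [set t | f t = x]) (G t)%:E)%E.
Proof.
move=> mf mG mA s_uniq s_full.
have mfiber x : measurable [set t | f t = x] by exact: measurable_fiber.
have fiber_disjoint : trivIset [set` s] (fun x => [set t | f t = x]).
  by move=> x y _ _ [t [<- <-]].
pose U := \big[setU/set0]_(x <- s) [set t | f t = x].
have mU : measurable U by exact: bigsetU_measurable.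
have PUC : P (~` U) = 0%E.
  rewrite probability_setC// /U -bigcup_seq measure_fin_bigcup//.
  by rewrite -fsbig_seq// s_full subee.
have mGin B : measurable_fun B (EFin \o G).
  exact/measurable_EFinP/measurable_funTS.
rewrite -[in LHS](setUIDK A U) integral_setU//; first last.
- by apply/disj_set2P; rewrite setDE setIACA setICr setI0.
- exact: measurableD.
- exact: measurableI.
rewrite [X in (_ + X)%E]null_set_integral//; first last.
- apply: (subset_measure0 (mu := P) _ _ _ PUC); first exact: measurableD.
    exact: measurableC.
  exact: subIsetr.
- exact: measurableD.
rewrite adde0 /U big_distrr/= integral_bigsetU_EFin// => [x|].
  exact: measurableI.
exact: trivIset_setIl.
Qed.

Context {I : eqType} (law : I -> seq (R * R)).
Context (valid : I -> bool) (F : I -> T -> R).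
Hypothesis law_sum1 : forall i, \sum_(a <- law i) a.2 = 1.
Hypothesis law_uniq : forall i, valid i -> uniq (unzip1 (law i)).
Hypothesis mF : forall i, valid i -> measurable_fun setT (F i).
Hypothesis F_law : forall i a, valid i -> a \in law i ->
  P [set t | F i t = a.1] = a.2%:E.
Hypothesis F_indep : discrete_mutually_independent P valid F.

Local Notation cylinder s v := [set t | all (fun i => F i t == v i) s].

Lemma cylinder_cons i s v :
  cylinder (i :: s) v = [set t | F i t = v i] `&` cylinder s v.
Proof. by apply/seteqP; split => t /= => [/andP[/eqP]|[/eqP -> ->]]. Qed.

Lemma cylinder_determined s : determined_by s (fun v => cylinder s v).
Proof.
move=> u v uv; apply/funext => t /=; congr is_true.
by apply: eq_in_all => i /uv ->.
Qed.

Lemma measurable_cylinder s v : all valid s -> measurable (cylinder s v).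
Proof.
elim: s => [_|i s IH /= /andP[vi vs]].
  by rewrite (_ : [set _ | _] = setT)//; exact/seteqP.
rewrite cylinder_cons.
by apply: measurableI; [exact/measurable_fiber/mF|exact: IH].
Qed.

Lemma probability_cylinder_cons i s v : uniq (i :: s) -> all valid (i :: s) ->
  P (cylinder (i :: s) v) = (P [set t | F i t = v i] * P (cylinder s v))%E.
Proof.
move=> us vs; rewrite F_indep// big_cons F_indep//.
  by case/andP: us.
by case/andP: vs.
Qed.

Lemma integral_cylinder (phi : (I -> R) -> R) s s' v :
  determined_by (s ++ s') phi -> measurable_fun setT (fun t => phi (F ^~ t)) ->
  uniq (s ++ s') -> all valid (s ++ s') ->
  (\int[P]_(t in cylinder s' v) (phi (F ^~ t))%:E)%E =
    (P (cylinder s' v) * (iexpect law s phi v)%:E)%E.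
Proof.
move=> + mphi; elim: s s' v => [s' v phi_s us vs|i s IH s' v phi_s us vs].
  rewrite (eq_integral (cst (phi v)%:E)) => [|t /[!inE]/= /allP tv].
    by rewrite integral_cst; [rewrite muleC|exact: measurable_cylinder].
  by congr EFin; apply: phi_s => j /tv/eqP.
have perm : perm_eq (s ++ i :: s') ((i :: s) ++ s').
  by rewrite -cat_rcons perm_cat2r perm_rcons.
have us' : uniq (s ++ i :: s') by rewrite (perm_uniq perm).
have vs' : all valid (s ++ i :: s') by rewrite (perm_all _ perm).
have phi_s' : determined_by (s ++ i :: s') phi.
  by apply: sub_determined_by phi_s => j; rewrite (perm_mem perm).
have := us'; rewrite cat_uniq => /and3P[_ _ /[dup] uis' /andP[is' _]].
have := vs'; rewrite all_cat => /andP[_ /[dup] vis' /andP[vi vs1]].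
have mcyl : measurable (cylinder s' v) by exact: measurable_cylinder.
rewrite (integral_fibers (mF vi) mphi _ (law_uniq vi))//; last first.
  rewrite big_map -(law_sum1 i) -sumEFin.
  by apply: eq_big_seq => a /F_law ->.
rewrite big_map /= -[P (cylinder s' v)]fineK ?fin_num_measure//.
rewrite -EFinM big_distrr /= -sumEFin; apply: eq_big_seq => a aA.
pose va := [eta v with i |-> a.1].
have cyl_va : cylinder s' va = cylinder s' v.
  exact: determined_by_update (@cylinder_determined s') is'.
have va_i : va i = a.1 by rewrite /va /= eqxx.
have -> : cylinder s' v `&` [set t | F i t = a.1] = cylinder (i :: s') va.
  by rewrite cylinder_cons cyl_va va_i setIC.
rewrite IH// probability_cylinder_cons// cyl_va va_i F_law//.
by rewrite -[P (cylinder s' v)]fineK ?fin_num_measure// -!EFinM mulrCA mulrA.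
Qed.

Lemma integral_iexpect (phi : (I -> R) -> R) s v :
  determined_by s phi -> measurable_fun setT (fun t => phi (F ^~ t)) ->
  uniq s -> all valid s ->
  (\int[P]_t (phi (F ^~ t))%:E)%E = (iexpect law s phi v)%:E.
Proof.
move=> phi_s mphi us vs; have := @integral_cylinder phi s [::] v.
rewrite cats0 (_ : [set _ | _] = setT); last exact/seteqP.
by rewrite probability_setT mul1e; apply.
Qed.

End expectation_of_independent.

Section elephant_walk.
Context {T : Type} {R : realType}.
Variables (X1 : T -> R) (eta : nat -> T -> R) (K : nat -> T -> nat).

Local Notation steps := (elephant_steps X1 eta K).
Local Notation X := (elephant_X X1 eta K).
Local Notation S := (elephant_S X1 eta K).

Lemma elephant_stepsS n t : (0 < n)%N -> steps n.+1 t =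
  rcons (steps n t) (eta n.+1 t *
    nth 0 (steps n t) (if n == 1%N then 0%N else (K n.+1 t).-1)).
Proof. by case: n. Qed.

Lemma size_elephant_steps n t : size (steps n t) = n.
Proof.
by elim: n => // -[//|n] IH; rewrite elephant_stepsS// size_rcons IH.
Qed.

Lemma nth_elephant_steps n k t : (k < n)%N -> nth 0 (steps n t) k = X k.+1 t.
Proof.
elim: n => // n IH; rewrite ltnS leq_eqVlt => /predU1P[->//|kn].
rewrite elephant_stepsS ?(leq_trans _ kn)// nth_rcons size_elephant_steps kn.
exact: IH.
Qed.

Lemma elephant_X1 t : X 1 t = X1 t.
Proof. by []. Qed.

Lemma elephant_X2 t : X 2 t = eta 2%N t * X1 t.
Proof. by []. Qed.

Lemma elephant_XS n k t : (1 < n)%N -> K n.+1 t = k -> (0 < k <= n)%N ->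
  X n.+1 t = eta n.+1 t * X k t.
Proof.
move=> n_gt1 Kk /andP[k_gt0 kn]; have n_gt0 := ltnW n_gt1.
rewrite /elephant_X elephant_stepsS// nth_rcons size_elephant_steps ltnn eqxx.
by rewrite gtn_eqF// Kk nth_elephant_steps prednK.
Qed.

Lemma elephant_SS n t : S n.+1 t = S n t + X n.+1 t.
Proof. by rewrite /elephant_S big_nat_recr. Qed.

Lemma elephant_X_norm_le1 n t : `|X1 t| <= 1 ->
  (forall k, (1 < k)%N -> `|eta k t| <= 1) -> `|X n t| <= 1.
Proof.
move=> X1_le1 eta_le1; rewrite /elephant_X; move: n.-1 => j.
elim: n j => [|[|n] IH] j; first by rewrite nth_nil normr0.
  by case: j => [|j]//=; rewrite nth_nil normr0.
rewrite elephant_stepsS// nth_rcons; case: ifP => // _; case: ifP => _.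
  by rewrite normrM mulr_ile1// eta_le1.
by rewrite normr0.
Qed.

Lemma elephant_S_norm_le n t : `|X1 t| <= 1 ->
  (forall k, (1 < k)%N -> `|eta k t| <= 1) -> `|S n t| <= n%:R.
Proof.
move=> X1_le1 eta_le1; elim: n => [|n IH].
  by rewrite /elephant_S big_geq// normr0.
rewrite elephant_SS -natr1 (le_trans (ler_normD _ _))// lerD//.
exact: elephant_X_norm_le1.
Qed.

End elephant_walk.

Lemma eq_elephant_steps {T T' : Type} {R : realType} (X1 : T -> R)
    (eta : nat -> T -> R) (K : nat -> T -> nat) (X1' : T' -> R)
    (eta' : nat -> T' -> R) (K' : nat -> T' -> nat) n t t' :
  X1 t = X1' t' ->
  (forall k, (1 < k <= n)%N -> eta k t = eta' k t') ->
  (forall k, (2 < k <= n)%N -> K k t = K' k t') ->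
  elephant_steps X1 eta K n t = elephant_steps X1' eta' K' n t'.
Proof.
move=> eqX1; elim: n => [//|[_ _ _ /=|n IH eq_eta eqK]]; first by rewrite eqX1.
have -> := elephant_stepsS X1 eta K t (ltn0Sn n).
have -> := elephant_stepsS X1' eta' K' t' (ltn0Sn n).
rewrite -IH => [|k /andP[k1 kn]|k /andP[k2 kn]]; first last.
- by apply: eqK; rewrite k2 leqW.
- by apply: eq_eta; rewrite k1 leqW.
rewrite eq_eta ?leqnn//; case: (eqVneq n.+1 1%N) => // n_neq0.
by rewrite eqK// leqnn andbT; case: (n) n_neq0.
Qed.

Lemma set_natr_eq (T : Type) (R : realType) (N : T -> nat) k :
  [set t | (N t)%:R = k%:R :> R] = [set t | N t = k].
Proof.
by apply/seteqP; split => t /= => [/eqP|->//]; rewrite eqr_nat => /eqP.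
Qed.

Section measurability.
Context {d : measure_display} {T : measurableType d} {R : realType}.

Lemma measurable_fun_random_index (N : T -> nat) (f : nat -> T -> R) :
  (forall k, measurable [set t | N t = k]) ->
  (forall k, measurable_fun setT (f k)) ->
  measurable_fun setT (fun t => f (N t) t).
Proof.
move=> mN mf; rewrite (_ : setT = \bigcup_k [set t | N t = k]); last first.
  by apply/seteqP; split => // t _; exists (N t).
apply/measurable_fun_bigcup => // k.
apply: (eq_measurable_fun (f k)) => [t /[!inE]/= -> //|].
exact: measurable_funTS.
Qed.

Variables (X1 : T -> R) (eta : nat -> T -> R) (K : nat -> T -> nat).
Hypothesis mX1 : measurable_fun setT X1.
Hypothesis meta : forall n, (2 <= n)%N -> measurable_fun setT (eta n).
Hypothesis mK : forall n, (3 <= n)%N ->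
  measurable_fun setT (fun t => (K n t)%:R : R).

Lemma measurable_nth_elephant_steps n j :
  measurable_fun setT (fun t => nth 0 (elephant_steps X1 eta K n t) j).
Proof.
elim: n j => [|[|n] IH] j.
- by under eq_fun do rewrite nth_nil; exact: measurable_cst.
- case: j => [//|j]; under eq_fun do rewrite nth_default//.
  exact: measurable_cst.
under eq_fun do rewrite elephant_stepsS// nth_rcons size_elephant_steps.
case: (j < n.+1)%N; first exact: IH.
case: (j == n.+1); last exact: measurable_cst.
apply: measurable_funM; first exact: meta.
have [_|n_neq0] := eqVneq n.+1 1%N; first exact: IH.
apply: (measurable_fun_random_index
    (f := fun k t => nth 0 (elephant_steps X1 eta K n.+1 t) k.-1)) => [k|k].
  by rewrite -(@set_natr_eq _ R); apply/measurable_fiber/mK; case: (n) n_neq0.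
exact: IH.
Qed.

Lemma measurable_elephant_S n : measurable_fun setT (elephant_S X1 eta K n).
Proof. by apply: measurable_sum => k; exact: measurable_nth_elephant_steps. Qed.

End measurability.

Definition driving_time (i : idx) : nat :=
  match i with None => 0 | Some (inl n) => n | Some (inr n) => n end.

Definition innovations (n : nat) : seq idx :=
  [seq i <- [:: Some (inl n); Some (inr n)] | valid_idx i].

Definition history (n : nat) : seq idx :=
  None :: flatten [seq innovations k | k <- iota 1 n].

Lemma historyS n : history n.+1 = history n ++ innovations n.+1.
Proof.
by rewrite /history -(addn1 n) iotaD map_cat flatten_cat/= cats0 add1n addn1.
Qed.

Lemma mem_innovations n i :
  (i \in innovations n) = [&& valid_idx i, i != None & driving_time i == n].
Proof.
by rewrite mem_filter !inE; congr andb; case: i => [[k|k]|]//; rewrite orbF.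
Qed.

Lemma mem_history n i :
  (i \in history n) = valid_idx i && (driving_time i <= n)%N.
Proof.
elim: n => [|n IH]; first by case: i => [[[|k]|[|k]]|]; rewrite /= ?andbF.
rewrite historyS mem_cat IH mem_innovations -andb_orr [(_ <= n.+1)%N]leq_eqVlt.
by case: i {IH} => [i|]//=; rewrite orbC.
Qed.

Lemma subset_history m n : (m <= n)%N -> {subset history m <= history n}.
Proof.
by move=> mn i; rewrite !mem_history => /andP[-> im]; exact: leq_trans mn.
Qed.

Lemma history_valid n : all valid_idx (history n).
Proof. by apply/allP => i; rewrite mem_history => /andP[]. Qed.

Lemma history_innovations_disjoint n :
  ~~ has (mem (innovations n.+1)) (history n).
Proof.
apply/hasPn => i; rewrite mem_history => /andP[_ i_le] /=.
by rewrite mem_innovations (ltn_eqF (n := n.+1)) ?andbF.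
Qed.

Lemma history_uniq n : uniq (history n).
Proof.
elim: n => // n IH; rewrite historyS cat_uniq IH filter_uniq// andbT.
by rewrite has_sym history_innovations_disjoint.
Qed.

Section coordinate_walk.
Context {R : realType}.
Implicit Types (u v : idx -> R) (n : nat).

(* The same walk on the space of values of the driving variables; [Num.trunc]
   reads off [K_n] from its real-valued copy. *)
Definition walk_memory n u : nat := Num.trunc (u (Some (inr n))).

Definition walk_X n u : R :=
  elephant_X (fun u => u None) (fun n u => u (Some (inl n))) walk_memory n u.

Definition walk_S n u : R :=
  elephant_S (fun u => u None) (fun n u => u (Some (inl n))) walk_memory n u.

Lemma walk_SS n u : walk_S n.+1 u = walk_S n u + walk_X n.+1 u.
Proof. exact: elephant_SS. Qed.

Lemma walk_X1 u : walk_X 1 u = u None.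
Proof. exact: elephant_X1. Qed.

Lemma walk_X_determined n : determined_by (history n) (@walk_X n).
Proof.
move=> u v uv; rewrite /walk_X /elephant_X; congr nth.
apply: eq_elephant_steps => [|k /andP[k_gt1 kn]|k /andP[k_gt2 kn]].
- exact: uv.
- by apply: uv; rewrite mem_history /= k_gt1.
- by rewrite /walk_memory uv// mem_history /= k_gt2.
Qed.

Lemma walk_S_determined n : determined_by (history n) (@walk_S n).
Proof.
elim: n => [|n IH] u v uv; first by rewrite /walk_S /elephant_S !big_geq.
rewrite !walk_SS (walk_X_determined uv); congr (_ + _).
exact: sub_determined_by (subset_history (leqnSn n)) IH _ _ uv.
Qed.

Lemma elephant_S_drive {T : Type} (X1 : T -> R) (eta : nat -> T -> R)
    (K : nat -> T -> nat) n t :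
  elephant_S X1 eta K n t = walk_S n (drive X1 eta K ^~ t).
Proof.
apply: eq_bigr => k _; rewrite /elephant_X; congr nth.
by apply: eq_elephant_steps => // m _; rewrite /walk_memory /= natrK.
Qed.

Lemma walk_XS_update n k e v : (1 < n)%N -> (0 < k <= n)%N ->
  walk_X n.+1 [eta [eta v with Some (inl n.+1) |-> e]
                          with Some (inr n.+1) |-> k%:R] = e * walk_X k v.
Proof.
move=> n_gt1 kn.
have nk_false : (n < k)%N = false by case/andP: kn => _; case: ltnP.
rewrite [LHS](elephant_XS _ _ n_gt1 _ kn)/= ?/walk_memory/= ?eqxx ?natrK//.
congr (_ * _); rewrite -/(walk_X _ _).
have X_det := @walk_X_determined k.
by rewrite !(determined_by_update _ _ X_det)// mem_history/= nk_false andbF.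
Qed.

Variables (p q r : R).

(* [n.-1] because [K_n] is uniform on [{1, n - 1}]. *)
Definition driving_law (i : idx) : seq (R * R) :=
  if i is Some (inr n) then [:: (1, 1 / 2); (n.-1%:R, 1 / 2)]
  else [:: (1, p); (-1, q); (0, r)].

Local Notation E := (iexpect driving_law).

Lemma driving_law_uniq i : valid_idx i -> uniq (unzip1 (driving_law i)).
Proof.
have sign_uniq : uniq [:: 1; -1; 0 : R].
  by rewrite /= !inE -addr_eq0 -[1 + 1]/2%:R pnatr_eq0 oppr_eq0 oner_eq0.
case: i => [[n|n]|] //= n_gt; rewrite !inE andbT eq_sym pnatr_eq1.
by case: n n_gt => [|[|[|]]].
Qed.

Lemma admissible_norm_le1 u : admissible driving_law u ->
  `|u None| <= 1 /\ forall n, `|u (Some (inl n))| <= 1.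
Proof.
move=> uA; split=> [|n]; [have := uA None|have := uA (Some (inl n))];
  by rewrite !inE => /or3P[]/eqP->; rewrite ?normrN1 ?normr1 ?normr0.
Qed.

Lemma walk_X_norm_le1 n u : admissible driving_law u -> `|walk_X n u| <= 1.
Proof. by move=> /admissible_norm_le1[? ?]; exact: elephant_X_norm_le1. Qed.

Lemma walk_S_norm_le n u : admissible driving_law u -> `|walk_S n u| <= n%:R.
Proof. by move=> /admissible_norm_le1[? ?]; exact: elephant_S_norm_le. Qed.

Hypothesis pqr : p + q + r = 1.

Lemma driving_law_sum1 i : \sum_(a <- driving_law i) a.2 = 1.
Proof.
by case: i => [[n|n]|]; rewrite !big_cons big_nil/=; have := pqr; lra.
Qed.

Lemma iexpect_walk_XS n v : (0 < n)%N ->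
  E (innovations n.+1) (walk_X n.+1) v = (p - q) / 2 * (v None + walk_X n v).
Proof.
case: n => [//|[_|n _]].
  by rewrite /= !big_cons big_nil walk_X1 /walk_X !elephant_X2/=; field.
rewrite /= !big_cons !big_nil/= !(walk_XS_update (k := 1))// walk_X1.
by rewrite !(walk_XS_update (k := n.+2)) ?leqnn//; field.
Qed.

End coordinate_walk.

Section walk_limit.
Context {R : realType}.
Variables (p q r : R).
Hypotheses (p_ge0 : 0 <= p) (q_ge0 : 0 <= q) (r_ge0 : 0 <= r).
Hypothesis pqr : p + q + r = 1.

Local Notation law := (driving_law p q r).
Local Notation E := (iexpect law).
Local Notation admissible := (admissible law).

Let law_sum1 : forall i, \sum_(a <- law i) a.2 = 1 := driving_law_sum1 pqr.

Lemma driving_law_ge0 i a : a \in law i -> 0 <= a.2.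
Proof.
case: i => [[n|n]|]; rewrite !inE; first [move=> /or3P[]|move=> /orP[]];
  by move=> /eqP->; rewrite ?divr_ge0.
Qed.

Definition memory_drift : R := (p - q) / (2 + q - p).

Local Notation L := memory_drift.

Lemma memory_drift_denominator_gt0 : 0 < 2 + q - p.
Proof. by have := pqr; have := q_ge0; have := r_ge0; lra. Qed.

Lemma memory_drift_norm_le1 : `|L| <= 1.
Proof.
have denom_gt0 := memory_drift_denominator_gt0.
rewrite normrM normfV (gtr0_norm denom_gt0) ler_pdivrMr// mul1r ler_norml.
by have := pqr; have := p_ge0; have := q_ge0; have := r_ge0; lra.
Qed.

Definition walk_martingale n u : R :=
  walk_S n u + L * walk_X n u - L * n%:R * u None.

Definition walk_increment n u : R :=
  (1 + L) * walk_X n.+1 u - L * (u None + walk_X n u).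

Lemma walk_martingaleS n u :
  walk_martingale n.+1 u = walk_martingale n u + walk_increment n u.
Proof. by rewrite /walk_martingale /walk_increment walk_SS -natr1; ring. Qed.

Lemma walk_martingale1 u : walk_martingale 1 u = u None.
Proof.
rewrite walk_martingaleS /walk_martingale /walk_increment walk_X1.
have -> : walk_S 0 u = 0 by rewrite /walk_S /elephant_S big_geq.
by ring.
Qed.

Lemma walk_martingale_determined n :
  determined_by (history n) (walk_martingale n).
Proof.
move=> u v uv; rewrite /walk_martingale.
by rewrite (walk_S_determined uv) (walk_X_determined uv) uv// mem_head.
Qed.

Lemma iexpect_walk_increment n v : (0 < n)%N ->
  E (innovations n.+1) (walk_increment n) v = 0.
Proof.
move=> n_gt0; have denom_gt0 := memory_drift_denominator_gt0.
rewrite iexpectB !iexpectZ iexpect_walk_XS//.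
rewrite (iexpect_determined law_sum1 (s := history n)); first last.
- exact: history_innovations_disjoint.
- by move=> u w uw; rewrite (walk_X_determined uw) uw// mem_head.
by rewrite /memory_drift; field; rewrite gt_eqF.
Qed.

Lemma walk_increment_norm_le4 n u : admissible u -> `|walk_increment n u| <= 4.
Proof.
move=> uA; rewrite (_ : 4 = (1 + 1) * 1 + 1 * (1 + 1)); last by ring.
have [X1_le1 _] := admissible_norm_le1 uA.
have X_le1 k := walk_X_norm_le1 k uA; have L_le1 := memory_drift_norm_le1.
rewrite (le_trans (ler_normB _ _))// (normrM (1 + L)) (normrM L) lerD ?ler_pM//.
  by rewrite (le_trans (ler_normD _ _))// normr1 lerD.
by rewrite (le_trans (ler_normD _ _))// lerD.
Qed.

Lemma iexpect_sqr_martingale_le n v : (0 < n)%N -> admissible v ->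
  E (history n) (fun u => walk_martingale n u ^+ 2) v <= 16 * n%:R.
Proof.
move=> + vA; case: n => // n _; elim: n => [|n IH].
  apply: (iexpect_le_cst law_sum1 driving_law_ge0) => // u uA.
  have [X1_le1 _] := admissible_norm_le1 uA; rewrite walk_martingale1.
  by rewrite (le_trans (ler_sqr_norm X1_le1))//; lra.
rewrite historyS iexpect_cat.
apply: (@le_trans _ _ (E (history n.+1)
    (fun u => walk_martingale n.+1 u ^+ 2 + 16) v)); last first.
  by rewrite iexpectD iexpect_cst// -(natr1 n.+1) mulrDr mulr1 lerD2r.
apply: (ler_iexpect driving_law_ge0) => // u uA.
under eq_fun do rewrite walk_martingaleS.
rewrite (iexpect_sqr_addr law_sum1 (s := history n.+1)); first last.
- exact: iexpect_walk_increment.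
- exact: history_innovations_disjoint.
- exact: walk_martingale_determined.
rewrite lerD2l (iexpect_le_cst law_sum1 driving_law_ge0)// => w wA.
by rewrite (le_trans (ler_sqr_norm (walk_increment_norm_le4 _ wA)))//; lra.
Qed.

Lemma iexpect_sqr_deviation_le n v : (0 < n)%N -> admissible v ->
  E (history n) (fun u => (walk_S n u / n%:R - L * u None) ^+ 2) v <=
  34 / n%:R.
Proof.
move=> n_gt0 vA; have n_gt0R : 0 < n%:R :> R by rewrite ltr0n.
apply: (@le_trans _ _ (E (history n)
    (fun u => 2 / n%:R ^+ 2 * (walk_martingale n u ^+ 2 + 1)) v)).
  apply: (ler_iexpect driving_law_ge0) => // u uA.
  have LX_le1 : `|L * walk_X n u| <= 1.
    by rewrite normrM mulr_ile1 ?memory_drift_norm_le1 ?(walk_X_norm_le1 _ uA).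
  have -> : walk_S n u / n%:R - L * u None =
      (walk_martingale n u - L * walk_X n u) / n%:R.
    by rewrite /walk_martingale; field; lra.
  rewrite expr_div_n [leRHS]mulrAC ler_pM2r ?invr_gt0 ?exprn_gt0//.
  move: (walk_martingale n u) (L * _) LX_le1 => M y.
  by rewrite ler_norml => /andP[? ?]; have := sqr_ge0 (M + y); nra.
rewrite iexpectZ iexpectD iexpect_cst// mulrAC ler_pdivrMr ?exprn_gt0//.
have n_ge1 : 1 <= n%:R :> R by rewrite ler1n.
have := iexpect_sqr_martingale_le n_gt0 vA.
have -> : 34 / n%:R * n%:R ^+ 2 = 34 * n%:R :> R by field; lra.
lra.
Qed.

Lemma iexpect_initial (g : R -> R) n v :
  E (history n) (fun u => g (u None)) v = p * g 1 + r * g 0 + q * g (- 1).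
Proof.
have rest_cst a : E (behead (history n)) (fun u => g (u None))
    [eta v with None |-> a] = g a.
  rewrite (iexpect_determined law_sum1 (s := [:: None])) => [//|u w uw|].
    by rewrite uw// mem_head.
  by have /andP[none_notin _] := history_uniq n; rewrite /= orbF.
by rewrite /= !big_cons big_nil !rest_cst/=; ring.
Qed.

Lemma cvg_iexpect_walk (f : R -> R) v : continuous f -> admissible v ->
  E (history n) (fun u => f (walk_S n u / n%:R)) v @[n --> \oo] -->
  limit_expect p q r f.
Proof.
move=> cf vA; apply/cvgrPdist_le => e e_gt0.
have e2_gt0 : 0 < e / 2 by rewrite divr_gt0.
have itv_compact : compact `[-1, 1 : R] by exact: segment_compact.
have := compact_continuous_sqr_modulus cf itv_compact e2_gt0.
move=> /(filterI (nbhs_pinfty_ge (num_real 0)))/filter_ex[C /= [C_ge0 f_mod]].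
near=> n; have n_gt0 : (0 < n)%N by near: n; exact: nbhs_infty_gt.
have -> : limit_expect p q r f = E (history n) (fun u => f (L * u None)) v.
  rewrite (iexpect_initial (fun x => f (L * x))) /limit_expect.
  by rewrite mulr0 mulr1 mulrN1.
rewrite -iexpectB (le_trans (ler_norm_iexpect driving_law_ge0 _ _ vA))//.
apply: (@le_trans _ _ (E (history n) (fun u =>
    e / 2 + C * (walk_S n u / n%:R - L * u None) ^+ 2) v)).
  apply: (ler_iexpect driving_law_ge0) => // u uA.
  rewrite -[X in _ + C * X]real_normK ?num_real// distrC f_mod//=.
    rewrite in_itv/= -ler_norml normrM normfV normr_nat ler_pdivrMr ?ltr0n//.
    by rewrite mul1r (walk_S_norm_le _ uA).
  rewrite in_itv/= -ler_norml normrM mulr_ile1 ?memory_drift_norm_le1//.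
  by have [] := admissible_norm_le1 uA.
rewrite iexpectD iexpect_cst// iexpectZ [leRHS]splitr lerD2l.
rewrite (le_trans (ler_wpM2l C_ge0 (iexpect_sqr_deviation_le n_gt0 vA)))//.
rewrite mulrA ler_pdivrMr ?ltr0n// -ler_pdivrMl//.
by near: n; exact: nbhs_infty_ger.
Unshelve. all: by end_near. Qed.

End walk_limit.

Section elephant_limit.
Context {d : measure_display} {T : measurableType d} {R : realType}.
Context (P : probability T R) {p q r : R}.
Variables (X1 : T -> R) (eta : nat -> T -> R) (K : nat -> T -> nat).
Hypotheses (p_ge0 : 0 <= p) (q_ge0 : 0 <= q) (r_ge0 : 0 <= r).
Hypothesis pqr : p + q + r = 1.
Hypothesis mX1 : measurable_fun setT X1.
Hypothesis meta : forall n, (2 <= n)%N -> measurable_fun setT (eta n).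
Hypothesis mK : forall n, (3 <= n)%N ->
  measurable_fun setT (fun t => (K n t)%:R : R).
Hypothesis X1_law : [/\ P [set t | X1 t = 1] = p%:E,
  P [set t | X1 t = -1] = q%:E & P [set t | X1 t = 0] = r%:E].
Hypothesis eta_law : forall n, (2 <= n)%N -> [/\ P [set t | eta n t = 1] = p%:E,
  P [set t | eta n t = -1] = q%:E & P [set t | eta n t = 0] = r%:E].
Hypothesis K_law : forall n, (3 <= n)%N ->
  P [set t | K n t = 1%N] = (1 / 2)%:E /\
  P [set t | K n t = n.-1] = (1 / 2)%:E.
Hypothesis indep : discrete_mutually_independent P valid_idx (drive X1 eta K).

Lemma measurable_drive i :
  valid_idx i -> measurable_fun setT (drive X1 eta K i).
Proof. by case: i => [[n|n]|] //= n_gt; [exact: meta|exact: mK]. Qed.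

Lemma drive_law i a : valid_idx i -> a \in driving_law p q r i ->
  P [set t | drive X1 eta K i t = a.1] = a.2%:E.
Proof.
case: i => [[n|n]|] /= n_gt; rewrite !inE.
- by have [? ? ?] := eta_law n_gt => /or3P[]/eqP->.
- have [K1 Kn] := K_law n_gt.
  by move=> /orP[]/eqP->; rewrite ?(set_natr_eq _ _ 1) ?set_natr_eq.
- by have [? ? ?] := X1_law => /or3P[]/eqP->.
Qed.

Lemma integral_elephant_walk (f : R -> R) n v : measurable_fun setT f ->
  (\int[P]_t (f (elephant_S X1 eta K n t / n%:R))%:E)%E =
  (iexpect (driving_law p q r) (history n)
     (fun u => f (walk_S n u / n%:R)) v)%:E.
Proof.
move=> mf; under eq_integral do rewrite elephant_S_drive.
apply: (integral_iexpect (P := P) (driving_law_sum1 pqr)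
  (@driving_law_uniq R p q r) measurable_drive drive_law indep
  (phi := fun u => f (walk_S n u / n%:R))).
- by move=> u w /walk_S_determined ->.
- under eq_fun do rewrite -elephant_S_drive.
  apply: (measurableT_comp mf); apply: measurable_funM => //.
  exact: measurable_elephant_S.
- exact: history_uniq.
- exact: history_valid.
Qed.

Lemma cvg_integral_elephant_walk (f : R -> R) : continuous f ->
  (fun n => (\int[P]_t (f (elephant_S X1 eta K n t / n%:R))%:E)%E) @ \oo -->
  (limit_expect p q r f)%:E.
Proof.
move=> cf; have mf := continuous_measurable_fun cf.
have one_adm : admissible (driving_law p q r) (fun=> 1).
  by case=> [[n|n]|]; rewrite !inE eqxx.
under eq_fun do rewrite (integral_elephant_walk _ (fun=> 1) mf).
apply: cvg_EFin; first exact: nearW.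
exact: cvg_iexpect_walk.
Qed.

End elephant_limit.

Theorem theorem8p1 (d : measure_display) (T : measurableType d) (R : realType)
  (P : probability T R) (p q r : R)
  (X1 : T -> R) (eta : nat -> T -> R) (K : nat -> T -> nat) :
  0 < p < 1 -> 0 < q < 1 -> 0 < r < 1 -> p + q + r = 1 ->
  measurable_fun setT X1 ->
  (forall n, (2 <= n)%N -> measurable_fun setT (eta n)) ->
  (forall n, (3 <= n)%N -> measurable_fun setT (fun t => (K n t)%:R : R)) ->
  P [set t | X1 t = 1] = p%:E ->
  P [set t | X1 t = -1] = q%:E ->
  P [set t | X1 t = 0] = r%:E ->
  (forall n, (2 <= n)%N ->
     [/\ P [set t | eta n t = 1] = p%:E,
         P [set t | eta n t = -1] = q%:E &
         P [set t | eta n t = 0] = r%:E]) ->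
  (forall n, (3 <= n)%N ->
     P [set t | K n t = 1%N] = (1 / 2)%:E /\
     P [set t | K n t = n.-1] = (1 / 2)%:E) ->
  discrete_mutually_independent P valid_idx (drive X1 eta K) ->
  let Sn n t := elephant_S X1 eta K n t / n%:R in
  [/\ (* convergence in distribution: E f(S_n/n) -> E f(S), f bounded continuous *)
      (forall f : R -> R, continuous f -> (exists M : R, forall x, `|f x| <= M) ->
         (fun n => (\int[P]_t (f (Sn n t))%:E)%E) @ \oo
           --> (limit_expect p q r f)%:E),
      (forall alpha : R, 0 < alpha ->
         (fun n => (\int[P]_t (`|Sn n t| `^ alpha)%:E)%E) @ \oo
           --> (limit_expect p q r (fun x => `|x| `^ alpha))%:E) &
      (forall k : nat, (0 < k)%N ->
         (fun n => (\int[P]_t ((Sn n t) ^+ k)%:E)%E) @ \oo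
           --> (limit_expect p q r (fun x => x ^+ k))%:E)].
Proof.
move=> /andP[/ltW p_ge0 _] /andP[/ltW q_ge0 _] /andP[/ltW r_ge0 _] pqr.
move=> mX1 meta mK X1p X1q X1r eta_law K_law indep Sn.
have cvg_Sn f : continuous f -> (\int[P]_t (f (Sn n t))%:E)%E @[n --> \oo] -->
    (limit_expect p q r f)%:E.
  exact: (cvg_integral_elephant_walk p_ge0 q_ge0 r_ge0 pqr mX1 meta mK
    (And3 X1p X1q X1r) eta_law K_law indep).
split=> [f cf _|alpha alpha_gt0|k _]; first exact: cvg_Sn.
- exact/(cvg_Sn (fun x => `|x| `^ alpha))/continuous_norm_powR.
- exact/(cvg_Sn (fun x => x ^+ k))/exprn_continuous.
Qed.
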